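(* Let $\mathcal{G}=(\mathcal{A},\lim(L(\mathfrak{A})))$ be a regular weighted limit game, where $\mathcal{A}$ has $n$ vertices and largest edge weight $W$, and let $s$ and $f$ be the number of states and accepting states of the DFA $\mathfrak{A}$ (with $\epsilon\notin L(\mathfrak{A})$). Then Player $0$ has an optimal strategy for $\mathcal{G}$ of size $nsf$ with $\mathrm{val}_{\mathcal{G}}(v)\le(ns+1)\cdot W$ for all vertices $v$ with $\mathrm{val}_{\mathcal{G}}(v)<\infty$, where $\mathrm{val}_{\mathcal{G}}(v)$ denotes the value from $v$ of an optimal strategy for Player $0$.
   Context: $\mathbb{N}$ denotes the nonnegative integers, $\overline{\mathbb{N}}=\mathbb{N}\cup\{\infty\}$ with $n<\infty$ and $n+\infty=\infty$ for every $n\in\mathbb{N}$; $\min\emptyset=\infty$. Fix a finite nonempty set $C$ of colors. A DFA $\mathfrak{A}=(Q,C,q_I,\delta,F)$ has finite state set $Q$, initial state $q_I\in Q$, transition function $\delta\colon Q\times C\to Q$ and accepting states $F\subseteq Q$; $L(\mathfrak{A})\subseteq C^*$ is its language. An arena $\mathcal{A}=(V,V_0,V_1,E,w,c)$ consists of a finite directed graph $(V,E)$ in which every vertex has an outgoing edge, a partition of $V$ into vertices $V_0$ of Player $0$ and $V_1$ of Player $1$, a weight function $w\colon E\to\mathbb{N}$ and a coloring $c\colon V\to C$. A play is an infinite path $\rho=v_0v_1v_2\cdots$. The weight of a finite path is the sum of the weights of its edges; $c$ is applied vertex-wise to paths. For $K\subseteq C^*$ with $\epsilon\notin K$, $\lim(K)$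 is the set of $\alpha_0\alpha_1\cdots\in C^\omega$ with $\alpha_0\cdots\alpha_j\in K$ for infinitely many $j$. A weighted limit game is $\mathcal{G}=(\mathcal{A},\lim(K))$; it is regular if $K=L(\mathfrak{A})$ for a DFA $\mathfrak{A}$ over $C$. The value of a play (depending on $K$) is $$\mathrm{val}_{\mathcal{G}}(v_0v_1v_2\cdots)=\sup_{j\in\mathbb{N}}\ \min_{j'>j,\ c(v_0\cdots v_{j'})\in K} w(v_j\cdots v_{j'})\in\overline{\mathbb{N}}.$$ A strategy for Player $i$ is a map $\sigma\colon V^*V_i\to V$ with $(v_j,\sigma(v_0\cdots v_j))\in E$ for every $v_0\cdots v_j\in V^*V_i$; a play $v_0v_1v_2\cdots$ is consistent with $\sigma$ if $v_{j+1}=\sigma(v_0\cdots v_j)$ whenever $v_j\in V_i$. For a strategy $\sigma$ of Player $0$, $\mathrm{val}_{\mathcal{G}}(\sigma,v)=\sup_\rho\mathrm{val}_{\mathcal{G}}(\rho)$ over all plays $\rho$ starting in $v$ and consistent with $\sigma$. A strategy $\sigma$ for Player $0$ is optimal if $\mathrm{val}_{\mathcal{G}}(\sigma,v)\le\mathrm{val}_{\mathcal{G}}(\sigma',v)$ for every strategy $\sigma'$ for Player $0$ and every vertex $v$. A memory structure $(M,\mathrm{init},\mathrm{upd})$ has a finite set $M$, $\mathrm{init}\colon V\to M$ and $\mathrm{upd}\colon M\times V\to M$; $\mathrm{upd}^*(v)=\mathrm{init}(v)$ and $\mathrm{upd}^*(\pi v)=\mathrm{upd}(\mathrm{upd}^*(\pi),v)$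 for nonempty $\pi\in V^*$. A strategy $\sigma$ for Player $i$ is implemented by it if for some $\mathrm{Nxt}\colon V_i\times M\to V$ with $(v,\mathrm{Nxt}(v,m))\in E$ for all $v\in V_i$, $m\in M$, one has $\sigma(v_0\cdots v_j)=\mathrm{Nxt}(v_j,\mathrm{upd}^*(v_0\cdots v_j))$. A strategy has size $m$ if it is implemented by a memory structure with $|M|=m$.
   Formalization: The automaton is assumed to have at least one accepting state (f ≥ 1); for f = 0 and a nonempty arena the claim fails, since a memory structure of size nsf = 0 cannot receive the map init from the vertices. *)

(* Defs.v *)
From mathcomp Require Import all_boot.
From mathcomp Require Import boolp classical_sets.

Set Implicit Arguments.
Unset Strict Implicit.
Unset Printing Implicit Defensive.

Local Open Scope classical_set_scope.

(* The extended naturals; [None] is infinity. *)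
Definition enat := option nat.
Definition infty : enat := None.

Definition enat_le (x y : enat) : bool :=
  match x, y with
  | _, None => true
  | None, Some _ => false
  | Some m, Some n => m <= n
  end.

Definition enat_min (A : set nat) : enat :=
  match pselect (exists n, `[< A n >]) with
  | left exA => Some (ex_minn exA)
  | right _ => infty
  end.

(* Least natural upper bound, and infinity if there is none. *)
Definition enat_sup (X : set enat) : enat :=
  enat_min [set n | forall x, X x -> enat_le x (Some n)].

Lemma enat_min_lb (A : set nat) n : A n -> enat_le (enat_min A) (Some n).
Proof.
move=> An; rewrite /enat_min; case: pselect => [exA|[]]; last first.
  by exists n; apply/asboolP.
by case: ex_minnP => m _ /(_ n) /=; apply; apply/asboolP.
Qed.

Lemma enat_min_mem (A : set nat) n : enat_min A = Some n -> A n.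
Proof.
rewrite /enat_min; case: pselect => // exA [<-].
by case: ex_minnP => m /asboolP.
Qed.

Lemma enat_min_set0 : enat_min set0 = infty.
Proof. by rewrite /enat_min; case: pselect => // h; exfalso; case: h => n /asboolP. Qed.

Lemma enat_sup_ub (X : set enat) x : X x -> enat_le x (enat_sup X).
Proof.
move=> Xx; case e: (enat_sup X) => [n|]; last by case: x Xx.
exact: (enat_min_mem e).
Qed.

Lemma enat_sup_le (X : set enat) y :
  (forall x, X x -> enat_le x y) -> enat_le (enat_sup X) y.
Proof.
case: y => [n|_]; last by case: (enat_sup X).
by move=> h; apply: enat_min_lb.
Qed.

Record dfa (C : finType) := DFA {
  dfa_state : finType;
  dfa_init : dfa_state;
  dfa_trans : dfa_state -> C -> dfa_state;
  dfa_accepting : {set dfa_state}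
}.

Definition language (C : finType) (D : dfa C) : set (seq C) :=
  [set u | foldl (@dfa_trans C D) (dfa_init D) u \in dfa_accepting D].

(* The vertices of Player 1 are those outside [player0].  Only the values of
   [weight] on edges are ever used. *)
Record arena (C : finType) := Arena {
  vertex : finType;
  player0 : {set vertex};
  edge : rel vertex;
  weight : vertex -> vertex -> nat;
  color : vertex -> C;
  edge_total : forall v, exists v', edge v v'
}.

Definition max_weight (C : finType) (A : arena C) : nat :=
  \max_(e : vertex A * vertex A | edge e.1 e.2) weight e.1 e.2.

(* The weighted limit game (A, lim(K)).  The game carries K because values
   depend on K and not only on lim(K). *)
Record wlgame (C : finType) := WLGame {
  game_arena : arena C;
  target : set (seq C);
  eps_notin_target : ~ target [::]
}.

Definition regular_game (C : finType) (A : arena C) (D : dfa C)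
    (epsD : ~ language D [::]) : wlgame C :=
  WLGame A epsD.

Section Game.
Variables (C : finType) (G : wlgame C).
Let V := vertex (game_arena G).
Let V0 := player0 (game_arena G).

Definition is_play (rho : nat -> V) : Prop :=
  forall i, edge (rho i) (rho i.+1).

Definition infix_weight (rho : nat -> V) (j j' : nat) : nat :=
  \sum_(j <= i < j') weight (rho i) (rho i.+1).

Definition play_value (rho : nat -> V) : enat :=
  enat_sup [set enat_min [set infix_weight rho j j' | j' in
              [set j' | j < j' /\
                target G [seq color (rho i) | i <- iota 0 j'.+1]]]
           | j in [set: nat]].

(* A nonempty sequence of vertices is given by its head [x] and its tail [p],
   so its last vertex is [last x p]; the values of a strategy on sequences not
   ending in a vertex of Player 0 are irrelevant. *)
Definition is_strategy (sigma : V -> seq V -> V) : Prop :=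
  forall x p, last x p \in V0 -> edge (last x p) (sigma x p).

Definition consistent (sigma : V -> seq V -> V) (rho : nat -> V) : Prop :=
  forall j, rho j \in V0 ->
    rho j.+1 = sigma (rho 0) [seq rho i | i <- iota 1 j].

Definition strategy_value (sigma : V -> seq V -> V) (v : V) : enat :=
  enat_sup [set play_value rho | rho in
    [set rho | [/\ is_play rho, rho 0 = v & consistent sigma rho]]].

Definition optimal (sigma : V -> seq V -> V) : Prop :=
  is_strategy sigma /\
  forall sigma', is_strategy sigma' ->
    forall v, enat_le (strategy_value sigma v) (strategy_value sigma' v).

Record memory_structure := MemoryStructure {
  memory : finType;
  mem_init : V -> memory;
  mem_upd : memory -> V -> memory
}.

Definition upd_star (S : memory_structure) (x : V) (p : seq V) : memory S :=
  foldl (@mem_upd S) (mem_init S x) p.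

Definition implements (S : memory_structure) (sigma : V -> seq V -> V) : Prop :=
  exists2 nxt : V -> memory S -> V,
    forall v m, v \in V0 -> edge v (nxt v m) &
    forall x p, last x p \in V0 ->
      sigma x p = nxt (last x p) (upd_star S x p).

Definition has_size (sigma : V -> seq V -> V) (m : nat) : Prop :=
  exists2 S : memory_structure, implements S sigma & #|memory S| = m.

End Game.

(* Main.v *)
(** From a product state (vertex, automaton state), a play has value at most [k]
    iff every position is followed, within weight [k], by a strictly later
    accepting state.  Let [core k] be the largest set [X] of accepting states
    from each of which Player 0 can force a strictly later visit to [X] within
    weight [k].  The accepting states reachable under a strategy of value [k] form
    such a set, hence Player 0 can achieve value [k] from [v] iff she can force a
    visit to [core k] within weight [k].  For the least such [k] she does so by
    moving, from every product state, so as to decrease lexicographically the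
    pair (least weight, least number of steps) needed to visit [core k]; this
    depends only on [v] and on the product state.  Finally, an attractor in the
    product is reached within [n * s] steps, which bounds all finite values by
    [n * s * W]. *)
Require Import Defs.
From mathcomp Require Import all_boot.
From mathcomp Require Import boolp classical_sets.
From mathcomp Require Import zify.

Set Implicit Arguments.
Unset Strict Implicit.
Unset Printing Implicit Defensive.

(** * Product states and forcing within a weight budget *)

Section Product.
Variables (C : finType) (A : arena C) (D : dfa C).

Local Notation V := (vertex A).
Local Notation state := (vertex A * dfa_state D)%type.
Local Notation edge := (@edge C A).
Local Notation weight := (@weight C A).
Local Notation V0 := (player0 A).
Implicit Types (p : state) (X Y : {set state}) (v x y : V) (h : seq V).

Definition accepting : {set state} := [set p : state | p.2 \in dfa_accepting D].

Definition step p v : state := (v, dfa_trans p.2 (color v)).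

(** The automaton has already read the color of the current vertex, so acceptance here means that
    the colors of [x :: h] form a word of the language. *)
Definition state_after x h : state :=
  (last x h, foldl (@dfa_trans C D) (dfa_init D) (map (@color C A) (x :: h))).

Lemma state_after_rcons x h y :
  state_after x (rcons h y) = step (state_after x h) y.
Proof. by rewrite /state_after /step last_rcons -rcons_cons map_rcons foldl_rcons. Qed.

Definition cpre p (P : pred V) : bool :=
  if p.1 \in V0 then [exists v, edge p.1 v && P v]
  else [forall v, edge p.1 v ==> P v].

Lemma cpre_mono p (P P' : pred V) :
  (forall v, edge p.1 v -> P v -> P' v) -> cpre p P -> cpre p P'.
Proof.
move=> PP'; rewrite /cpre; case: ifP => _.
  by case/existsP=> v /andP[e Pv]; apply/existsP; exists v; rewrite e PP'.
by move=> /forallP Pall; apply/forallP=> v; apply/implyP=> e;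
   apply: PP' => //; apply: implyP (Pall v) e.
Qed.

(** Supplies moves against a fixed strategy of Player 0: [u] is the move it prescribes, so at her
    vertices [u] itself must witness the failure. *)
Lemma cpre_counter p (P : pred V) (u : V) : edge p.1 u -> ~~ cpre p P ->
  exists v, [/\ edge p.1 v, p.1 \in V0 -> v = u & ~~ P v].
Proof.
move=> eu; rewrite /cpre; case: ifP => _.
  rewrite negb_exists => /forallP/(_ u); rewrite eu /= => nPu.
  by exists u.
by rewrite negb_forall => /existsP[v]; rewrite negb_imply => /andP[ev nPv]; exists v.
Qed.

(* Visits at the current state do not count, only strictly later ones. *)
Fixpoint force X b i p : bool :=
  if i is i'.+1 then
    cpre p (fun v => (weight p.1 v <= b) &&
      ((step p v \in X) || force X (b - weight p.1 v) i' (step p v)))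
  else false.

Definition win X b p : Prop := exists i, force X b i p.

Lemma force_mono X Y b b' i i' p :
  X \subset Y -> b <= b' -> i <= i' -> force X b i p -> force Y b' i' p.
Proof.
move=> XY; elim: i i' b b' p => [//|i IH] [//|i'] b b' p lb li /=.
apply: cpre_mono => v _ /andP[wb H]; rewrite (leq_trans wb lb) /=.
case/orP: H => [/(fintype.subsetP XY)->//|H].
by rewrite (IH _ _ _ _ _ _ H) ?orbT //; lia.
Qed.

Lemma win_mono X Y b b' p :
  X \subset Y -> b <= b' -> win X b p -> win Y b' p.
Proof. by move=> XY lb [i Hi]; exists i; apply: force_mono Hi. Qed.

(** There are finitely many successors, so the maximum of their step counts serves for all of
    them. *)
Lemma win_cpre X b p :
  cpre p (fun v => (weight p.1 v <= b) &&
    ((step p v \in X) || `[< win X (b - weight p.1 v) (step p v) >])) ->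
  win X b p.
Proof.
move=> H.
have /choice[t tP] : forall v, exists i,
    win X (b - weight p.1 v) (step p v) ->
    force X (b - weight p.1 v) i (step p v).
  move=> v; have [[i Hi]|nw] := pselect (win X (b - weight p.1 v) (step p v)).
    by exists i.
  by exists 0.
exists (\max_v t v).+1 => /=; apply: cpre_mono H => v _ /andP[-> /=].
case/orP=> [->//|/asboolP/tP H]; apply/orP; right.
by apply: force_mono H => //; apply: leq_bigmax.
Qed.

(** * Lexicographic ranks and the moves that decrease them *)

Definition minimal X b i p :=
  [/\ force X b i p, forall b', win X b' p -> b <= b'
    & forall i', force X b i' p -> i <= i'].

Lemma win_minimal X b p : win X b p ->
  exists b' i, b' <= b /\ minimal X b' i p.
Proof.
move=> wb; have exb : exists b, `[< win X b p >] by exists b; apply/asboolP.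
case: (ex_minnP exb) => b' /asboolP wb' bmin.
case: (ex_minnP wb') => i Hi imin.
exists b', i; split; first by apply: bmin; apply/asboolP.
by split=> // c wc; apply: bmin; apply/asboolP.
Qed.

Lemma minimal_uniq X b i b' i' p :
  minimal X b i p -> minimal X b' i' p -> b = b' /\ i = i'.
Proof.
move=> [Hf Hb Hi] [Hf' Hb' Hi'].
have e : b = b'.
  by apply/eqP; rewrite eqn_leq (Hb b' (ex_intro _ i' Hf')) (Hb' b (ex_intro _ i Hf)).
by subst b'; split=> //; apply/eqP; rewrite eqn_leq (Hi _ Hf') (Hi' _ Hf).
Qed.

Definition progress X b i p v :=
  weight p.1 v <= b /\
  (step p v \in X \/ force X (b - weight p.1 v) i.-1 (step p v)).

(** Where [X] cannot be forced, any edge qualifies, so moves can be chosen at every state. *)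
Definition good_move X p v :=
  edge p.1 v /\
  forall b i, minimal X b i p -> p.1 \in V0 -> progress X b i p v.

Lemma good_move_exists X p : exists v, good_move X p v.
Proof.
have [u eu] := edge_total p.1.
have [[b [i bi]]|no] := pselect (exists b i, minimal X b i p); last first.
  by exists u; split=> // b i bi; case: no; exists b, i.
have [pV0|pV1] := boolP (p.1 \in V0); last first.
  by exists u; split=> // ? ? _; rewrite (negbTE pV1).
case: (bi) => + _ _; case: i bi => [//|i] bi /=.
rewrite /cpre pV0 => /existsP[v /and3P[ev wv H]].
exists v; split=> // b' i' bi' _; have [<- <-] := minimal_uniq bi bi'.
by split=> //; apply/orP.
Qed.

(** An edge of weight 0 may leave the least budget unchanged; then the step count drops, so the
    visit to [X] cannot be delayed forever. *)
Lemma minimal_step X b i p v :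
    minimal X b i p -> edge p.1 v -> (p.1 \in V0 -> good_move X p v) ->
  weight p.1 v <= b /\
  (step p v \in X \/ exists b' i', [/\ minimal X b' i' (step p v),
      b' + weight p.1 v <= b & (b' < b) || (i' < i)]).
Proof.
move=> bi ev gm.
have : 0 < i /\ progress X b i p v.
  have i0 : 0 < i by case: bi; case: (i).
  split=> //; have [pV0|pV1] := boolP (p.1 \in V0).
    by case: (gm pV0) => _; apply.
  case: (bi) => + _ _; case: i i0 bi => [//|i] _ _ /=.
  rewrite /cpre (negbTE pV1) => /forallP/(_ v)/implyP/(_ ev)/andP[wv H].
  by split=> //; apply/orP.
move=> [i0 [wv [inX|H]]]; split=> //; first by left.
right; have [b' [i' [lb' bi']]] := win_minimal (ex_intro (fun i => force _ _ i _) _ H).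
exists b', i'; split=> //; first lia.
have [//|leb /=] := ltnP b' b.
(* Since [b <= b' <= b - weight p.1 v], the edge has weight 0, and [H] forces [X] in [i.-1] steps at
   the least budget. *)
have e : b - weight p.1 v = b' by lia.
case: bi' => _ _ /(_ i.-1); rewrite -e => /(_ H); lia.
Qed.

(** * Stable sets and the core *)

Definition stable k X :=
  X \subset accepting /\ forall p, p \in X -> win X k p.

Definition core k : {set state} :=
  [set p | `[< exists2 X, stable k X & p \in X >]].

Lemma stable_sub_core k X : stable k X -> X \subset core k.
Proof.
by move=> sX; apply/fintype.subsetP=> p pX; rewrite inE; apply/asboolP; exists X.
Qed.

(** The core is the union of all stable sets, and enlarging the target preserves [win]. *)
Lemma core_stable k : stable k (core k).
Proof.
split=> [|p]; first apply/fintype.subsetP=> p.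
  by rewrite inE => /asboolP[X [/fintype.subsetP sX _] /sX].
rewrite inE => /asboolP[X sX pX]; apply: win_mono (stable_sub_core sX) (leqnn _) _.
by case: sX => _; apply.
Qed.

Lemma weight_le_max x y : edge x y -> weight x y <= max_weight A.
Proof.
by move=> e; rewrite /max_weight
  (@leq_bigmax_cond _ (fun e => edge e.1 e.2) (fun e => weight e.1 e.2) (x, y)).
Qed.

(** * Attractors and the uniform weight bound *)

Section Attractor.
Variable X : {set state}.

Let pre Y : {set state} :=
  [set p | cpre p (fun v => (step p v \in X) || (step p v \in Y))].

Let pre_mono : {homo pre : Y Y' / Y \subset Y'}.
Proof.
move=> Y Y' /fintype.subsetP s; apply/fintype.subsetP=> p; rewrite !inE.
by apply: cpre_mono => v _ /orP[->//|/s ->]; rewrite orbT.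
Qed.

Let force_iter b i p : force X b i p -> p \in iter i pre finset.set0.
Proof.
elim: i b p => [//|i IH] b p /=; rewrite inE.
by apply: cpre_mono => v _ /andP[_ /orP[->//|/IH ->]]; rewrite orbT.
Qed.

Let iter_force i p : p \in iter i pre finset.set0 -> force X (i * max_weight A) i p.
Proof.
elim: i p => [p|i IH p] /=; first by rewrite inE.
rewrite inE; apply: cpre_mono => v /weight_le_max wv H.
rewrite mulSn (leq_trans wv (leq_addr _ _)) /=.
case/orP: H => [->//|/IH H]; apply/orP; right.
by apply: force_mono H => //; lia.
Qed.

(** Without budgets, [force] iterates a monotone operator on sets of product states, which
    stabilizes within as many rounds as there are states; each round costs at most the largest
    weight. *)
Lemma win_bound b p :
  win X b p -> win X (#|V| * #|dfa_state D| * max_weight A) p.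
Proof.
case=> i /force_iter Hi; exists #|{: state}|; rewrite -card_prod.
apply: iter_force; apply: (fintype.subsetP _ _ Hi).
exact: iter_sub_fix.
Qed.

End Attractor.

Lemma core_bound k :
  core k \subset core (#|V| * #|dfa_state D| * max_weight A).
Proof.
apply: stable_sub_core; have [sub w] := core_stable k.
by split=> // p /w /win_bound.
Qed.

(** * Values of plays that follow good moves *)

Section Values.
Hypothesis epsD : ~ language D [::].
Local Notation G := (regular_game A epsD).
Implicit Types (rho : nat -> V) (sigma : V -> seq V -> V).

Lemma map_iotaS rho j :
  [seq rho i | i <- iota 1 j.+1] = rcons [seq rho i | i <- iota 1 j] (rho j.+1).
Proof. by rewrite -[in LHS](addn1 j) iotaD map_cat cats1. Qed.

Definition state_at rho j := state_after (rho 0) [seq rho i | i <- iota 1 j].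

Lemma state_at1 rho j : (state_at rho j).1 = rho j.
Proof.
by case: j => [//|j]; rewrite /state_at /state_after map_iotaS last_rcons.
Qed.

Lemma state_atS rho j : state_at rho j.+1 = step (state_at rho j) (rho j.+1).
Proof.
by rewrite -state_after_rcons /state_at map_iotaS.
Qed.

Lemma enat_le_trans a b c : enat_le a b -> enat_le b c -> enat_le a c.
Proof. by case: a b c => [a|] [b|] [c|] //=; apply: leq_trans. Qed.

Lemma play_value_leP rho k :
  enat_le (play_value (G := G) rho) (Some k) <->
  forall j, exists j', [/\ j < j', state_at rho j' \in accepting
    & infix_weight (G := G) rho j j' <= k].
Proof.
have targetE j' : target G [seq color (rho i) | i <- iota 0 j'.+1] <->
    state_at rho j' \in accepting.
  by rewrite inE /state_at /state_after /= -map_comp.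
split=> [H j|H].
  have := enat_le_trans (enat_sup_ub _) H => /(_ _ (ex_intro2 _ _ j I erefl)).
  case e: (enat_min _) => [m|//] /= mk.
  have [j' [jj' /targetE acc] wE] := enat_min_mem e.
  by exists j'; split=> //; rewrite wE.
apply: enat_sup_le => _ [j _ <-]; have [j' [jj' acc wk]] := H j.
apply: (@enat_le_trans _ (Some (infix_weight (G := G) rho j j'))) => //.
by apply: enat_min_lb; exists j' => //; split=> //; apply/targetE.
Qed.

Lemma play_value_moves X k (mv : state -> V) rho :
    stable k X -> (forall p, good_move X p (mv p)) ->
    is_play (G := G) rho ->
    (forall j, rho j \in V0 -> rho j.+1 = mv (state_at rho j)) ->
    win X k (state_at rho 0) ->
  enat_le (play_value (G := G) rho) (Some k).
Proof.
move=> [Xacc Xwin] mvP play cons win0; apply/play_value_leP.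
have next j b i : minimal X b i (state_at rho j) ->
    weight (rho j) (rho j.+1) <= b /\ (state_at rho j.+1 \in X \/
      exists b' i', [/\ minimal X b' i' (state_at rho j.+1),
        b' + weight (rho j) (rho j.+1) <= b & (b' < b) || (i' < i)]).
  move=> bi; rewrite state_atS.
  have := @minimal_step X b i (state_at rho j) (rho j.+1) bi.
  rewrite state_at1; apply; first exact: play.
  by move=> /cons ->; apply: mvP.
(* Stability restores the budget [k] at each visit to [X]; in between, the least budget never
   grows. *)
have win_at j : win X k (state_at rho j).
  elim: j => [//|j /win_minimal[b [i [bk /next[_ [/Xwin //|[b' [i' [bi' lb _]]]]]]]]].
  by exists i'; case: bi' => fo _ _; apply: force_mono fo => //; lia.
(* Nested induction: on the budget, then on the step count at a fixed budget. *)
have reach b : forall i j, minimal X b i (state_at rho j) ->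
    exists j', [/\ j < j', state_at rho j' \in X
      & infix_weight (G := G) rho j j' <= b].
  elim/ltn_ind: b => b IHb i; elim/ltn_ind: i => i IHi j /next[wb].
  case=> [inX|[b' [i' [bi' lb dec]]]].
    by exists j.+1; split=> //; rewrite /infix_weight big_nat1.
  have [j' [jj' inX wj]] : exists j', [/\ j.+1 < j', state_at rho j' \in X
      & infix_weight (G := G) rho j.+1 j' <= b'].
    have [lbb|leb] := ltnP b' b; first exact: (IHb _ lbb i').
    have e : b' = b by lia.
    by rewrite e in bi' dec *; apply: IHi bi'; rewrite ltnn in dec.
  exists j'; split=> //; first exact: ltnW.
  by rewrite /infix_weight big_ltn ?(ltnW jj') //; move: wj; rewrite /infix_weight /=; lia.
move=> j; have [b [i [bk bi]]] := win_minimal (win_at j).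
have [j' [jj' inX wj]] := reach _ _ _ bi.
by exists j'; split=> //; [apply: (fintype.subsetP Xacc)|apply: leq_trans bk].
Qed.

(** * A strategy of value at most [k] forces the core *)

Section Lower.
Variables (sigma : V -> seq V -> V) (x : V) (k : nat).
Hypotheses (sigmaP : is_strategy (G := G) sigma)
  (value_k : enat_le (strategy_value (G := G) sigma x) (Some k)).

Definition legal_move h y :=
  edge (last x h) y /\ (last x h \in V0 -> y = sigma x h).

Definition legal h :=
  forall i, i < size h -> legal_move (take i h) (nth x h i).

Lemma legal_rcons h y : legal h -> legal_move h y -> legal (rcons h y).
Proof.
move=> lh ly i; rewrite size_rcons ltnS leq_eqVlt nth_rcons -cats1.
case/orP=> [/eqP->|li]; first by rewrite ltnn eqxx take_size_cat.
by rewrite li takel_cat ?(ltnW li) //; apply: lh.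
Qed.

Fixpoint path_weight y h : nat :=
  if h is z :: h' then weight y z + path_weight z h' else 0.

Lemma path_weight_rcons y h z :
  path_weight y (rcons h z) = path_weight y h + weight (last y h) z.
Proof. by elim: h y => [|z' h IH] y /=; rewrite ?addn0 // IH addnA. Qed.

Section Outcome.
Variable g : seq V -> V.

(** [g] picks the moves of both players and so determines a single play from [x]. *)
Definition history n := iter n (fun h => rcons h (g h)) [::].
Definition outcome n := last x (history n).

Lemma size_history n : size (history n) = n.
Proof. by elim: n => [//|n IH]; rewrite /history iterS size_rcons IH. Qed.

Lemma outcome_history n : [seq outcome i | i <- iota 1 n] = history n.
Proof.
elim: n => [//|n IH]; rewrite map_iotaS IH.
by rewrite /outcome /= last_rcons.
Qed.

Hypothesis gP : forall n, legal_move (history n) (g (history n)).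

Lemma history_legal n : legal (history n).
Proof. by elim: n => [//|n IH]; apply: legal_rcons. Qed.

Lemma outcome_value : enat_le (play_value (G := G) outcome) (Some k).
Proof.
apply: enat_le_trans value_k; apply: enat_sup_ub; exists outcome => //; split=> //.
- by move=> n; have [+ _] := gP n; rewrite {2}/outcome /= last_rcons.
- by move=> n nV0; rewrite outcome_history {1}/outcome /= last_rcons;
    have [_] := gP n; apply.
Qed.

Lemma infix_weight_outcome i j : i <= j ->
  path_weight x (history i) + infix_weight (G := G) outcome i j
    = path_weight x (history j).
Proof.
move=> ij; rewrite -(subnKC ij); elim: (j - i) => [|m IH].
  by rewrite addn0 /infix_weight big_geq ?addn0.
rewrite addnS /infix_weight big_nat_recr ?leq_addr //= addnA -[LHS]/(_ + _).
by rewrite [X in X + _]IH path_weight_rcons /outcome /= last_rcons.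
Qed.

End Outcome.

Let X : {set state} := [set p | (p \in accepting) &&
  `[< exists2 h, legal h & state_after x h = p >]].

(** [K] bounds the weight counted from [x]. Once it is exceeded only legality remains, so an
    escaping play can be continued forever. *)
Let escape K h := legal h /\ (path_weight x h <= K ->
  ~ win X (K - path_weight x h) (state_after x h)).

Let escape_next K h : escape K h -> exists y, [/\ legal_move h y,
  escape K (rcons h y) & path_weight x (rcons h y) <= K ->
    state_after x (rcons h y) \notin X].
Proof.
move=> [lh nw].
have [u [eu su]] : exists u, legal_move h u.
  have [hV0|hV1] := boolP (last x h \in V0).
    by exists (sigma x h); split=> //; apply: sigmaP.
  by have [u eu] := edge_total (last x h); exists u; split=> //; rewrite (negbTE hV1).
have [over|within] := ltnP K (path_weight x h).
  have over' : K < path_weight x (rcons h u).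
    by rewrite path_weight_rcons ltn_addr.
  by exists u; split=> //; [split=> //; first exact: legal_rcons|]; rewrite leqNgt over'.
(* Contraposing [win_cpre] gives a move, consistent with [sigma], that is too expensive or after
   which [X] is neither visited nor forceable within the remaining budget. *)
have /(@cpre_counter (state_after x h) _ u eu)[y [ey uy]] := contra_notN (@win_cpre _ _ _) (nw within).
rewrite negb_and negb_or => ny.
have ly : legal_move h y by split=> // hV0; rewrite uy // su.
have wE := path_weight_rcons x h y.
have small : path_weight x (rcons h y) <= K ->
  step (state_after x h) y \notin X /\
  ~ win X (K - path_weight x (rcons h y)) (step (state_after x h) y).
  rewrite wE => le; move: ny => /=.
  have -> : weight (last x h) y <= K - path_weight x h by lia.
  by rewrite subnDA => /= /andP[nX /asboolPn].
exists y; rewrite state_after_rcons; split=> //; last by case/small.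
by split; [exact: legal_rcons|rewrite state_after_rcons => /small[]].
Qed.

(** Otherwise [h] extends, consistently with [sigma], to a play that avoids [X] within weight [k]
    after [h]. Its value is at most [k], so an accepting state occurs in that range; being reachable
    under [sigma], it lies in [X]. *)
Lemma legal_win h : legal h -> win X k (state_after x h).
Proof.
move=> lh; apply: contrapT => nw.
pose K := path_weight x h + k.
have /choice[f fP] : forall h', exists y, escape K h' ->
    [/\ legal_move h' y, escape K (rcons h' y)
      & path_weight x (rcons h' y) <= K -> state_after x (rcons h' y) \notin X].
  move=> h'; have [/escape_next[y]|ne] := pselect (escape K h'); first by exists y.
  by exists x.
(* The play first follows [h], then escapes from [X]. *)
pose g h' := if size h' < size h then nth x h (size h') else f h'.
have Hbefore n : n <= size h -> history g n = take n h.
  elim: n => [|n IH] ln; first by rewrite take0.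
  rewrite (take_nth x ln) /history iterS -/(history g n) IH ?(ltnW ln) //.
  by rewrite /g size_takel ?(ltnW ln) // ln.
have Hafter n : escape K (history g (size h + n)).
  elim: n => [|n IH].
    rewrite addn0 Hbefore // take_size; split=> // _.
    by rewrite /K addKn.
  rewrite addnS /history iterS -/(history g (size h + n)).
  rewrite {2}/g size_history ltnNge leq_addr /=.
  by have [] := fP _ IH.
have gP n : legal_move (history g n) (g (history g n)).
  rewrite {2}/g size_history; have [nh|hn] := ltnP n (size h).
    by rewrite Hbefore ?(ltnW nh) //; apply: lh.
  by have := Hafter (n - size h); rewrite subnKC // => /fP[].
have [j [hj acc wk]] := (play_value_leP _ _).1 (outcome_value gP) (size h).
have stE : state_at (outcome g) j = state_after x (history g j).
  by rewrite /state_at outcome_history.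
have inX : state_after x (history g j) \in X.
  rewrite inE -stE acc; apply/asboolP; exists (history g j) => //.
  exact: history_legal.
have wK : path_weight x (history g j) <= K.
  rewrite -(infix_weight_outcome _ (ltnW hj)) Hbefore // take_size /K.
  by rewrite leq_add2l.
(* The accepting position lies strictly after [h], so its last move was made by [f], which avoids
   [X]. *)
case: j hj inX wK {acc wk stE} => [//|j] hj inX wK.
have := Hafter (j - size h); rewrite subnKC // => /fP[_ _].
have -> : f (history g j) = g (history g j).
  by rewrite /g size_history ltnNge -ltnS hj.
by move=> /(_ wK); rewrite inX.
Qed.

Lemma strategy_win : win (core k) k (state_after x [::]).
Proof.
have sX : stable k X.
  split=> [|p]; first by apply/fintype.subsetP=> p; rewrite inE => /andP[].
  by rewrite inE => /andP[_ /asboolP[h lh <-]]; apply: legal_win.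
by apply: win_mono (stable_sub_core sX) (leqnn k) _; apply: legal_win.
Qed.

End Lower.

End Values.

End Product.

(** * The optimal strategy, its memory and the bound *)

Theorem lemma8 (C : finType) (hC : 0 < #|C|) (A : arena C) (D : dfa C)
    (epsD : ~ language D [::]) (hF : 0 < #|dfa_accepting D|) :
  let G := regular_game A epsD in
  let n := #|vertex A| in
  let W := max_weight A in
  let s := #|dfa_state D| in
  let f := #|dfa_accepting D| in
  exists sigma : vertex A -> seq (vertex A) -> vertex A,
    [/\ optimal (G := G) sigma,
        has_size (G := G) sigma (n * s * f)
      & forall v, strategy_value (G := G) sigma v <> infty ->
          enat_le (strategy_value (G := G) sigma v) (Some ((n * s + 1) * W))].
Proof.
move=> G n W s f.
pose winning k v := win (core A D k) k (state_after D v [::]).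
(* [kv v] is the least winning threshold, with default 0 if there is none; the premise
   [winning k' v] makes the default harmless. *)
have /choice[kv kvP] : forall v, exists k, forall k', winning k' v ->
    winning k v /\ k <= k'.
  move=> v; have [exk|no] := pselect (exists k, `[< winning k v >]); last first.
    by exists 0 => k' wk'; case: no; exists k'; apply/asboolP.
  case: (ex_minnP exk) => k /asboolP wk kmin; exists k => k' wk'; split=> //.
  by apply: kmin; apply/asboolP.
have /choice[mv mvP] : forall v, exists mv, forall p,
    good_move (core A D (kv v)) p (mv p).
  move=> v; have [mv mvP] := choice (good_move_exists (core A D (kv v))).
  by exists mv.
(* The target core depends on [kv v], hence the moves depend on the initial vertex; this makes one
   strategy optimal from all vertices at once. *)
pose sigma v h := mv v (state_after D v h).
have sigmaP : is_strategy (G := G) sigma.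
  by move=> x h _; case: (mvP x (state_after D x h)).
have upper k v : winning k v -> enat_le (strategy_value (G := G) sigma v) (Some (kv v)).
  move=> /kvP[wk _]; apply: enat_sup_le => _ [rho [play rho0 cons] <-].
  refine (@play_value_moves _ _ _ epsD _ _ _ _ (core_stable A D (kv v)) (mvP v) play _ _).
    by move=> j /cons ->; rewrite /sigma rho0 /state_at rho0.
  by rewrite /state_at /= rho0.
exists sigma; split.
- split=> // sigma' sigmaP' v; case e: (strategy_value sigma' v) => [k|]; last first.
    by case: strategy_value.
  have wk : winning k v by apply: (strategy_win sigmaP'); rewrite e /=.
  by apply: enat_le_trans (upper _ _ wk) _; case: (kvP _ _ wk).
- have [q0 q0F] : exists q0, q0 \in dfa_accepting D by apply/card_gt0P.
  (* The memory stores the initial vertex and the automaton state; its third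
     component is never updated and only brings the size to [n * s * f]. *)
  pose M := (vertex A * dfa_state D * {q | q \in dfa_accepting D})%type.
  pose S := @MemoryStructure C G M
    (fun v => (v, dfa_trans (dfa_init D) (color v), exist _ q0 q0F))
    (fun m v => (m.1.1, dfa_trans m.1.2 (color v), m.2)).
  exists S; last by rewrite /= !card_prod card_sig.
  exists (fun v m => mv m.1.1 (v, m.1.2)) => [v m _|x h _].
    by case: (mvP m.1.1 (v, m.1.2)).
  suff -> : upd_star S x h =
      (x, (state_after D x h).2, exist _ q0 q0F) by [].
  elim/last_ind: h => [//|h y IH].
  by rewrite /upd_star foldl_rcons -/(upd_star S x h) IH state_after_rcons.
- move=> v; case e: (strategy_value (G := G) sigma v) => [k|] // _.
  have wk : winning k v by apply: (strategy_win sigmaP); rewrite e /=.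
  (* Both the core and the budget can be replaced by those for [n * s * W]; minimality of [kv v]
     then bounds the value. *)
  have wB : winning (n * s * W) v.
    exact: win_mono (core_bound A D k) (leqnn _) (win_bound wk).
  rewrite -e; apply: enat_le_trans (upper _ _ wk) _.
  by rewrite /= (leq_trans (kvP _ _ wB).2) // leq_mul2r leq_addr orbT.
Qed.
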